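(* There exists a topologically weakly mixing $\mathbb{Z}^3$-subshift of finite type which has topological completely positive entropy (topological CPE) and which does not have bounded chain exchangeability (BCE).
   Context: Let $G=\mathbb{Z}^3$. For a finite alphabet $\mathcal A$, a $G$-subshift is a subset $X\subset\mathcal A^{G}$ closed in the product topology and invariant under the shift $\sigma^g(x)_h=x_{g^{-1}h}$; it is of finite type (SFT) if it is the set of all configurations in which no pattern from some fixed finite set of forbidden finite patterns appears. A $G$-topological dynamical system $(X,T)$ is a compact metric space with a $G$-action by homeomorphisms; subshifts are such systems with $T=\sigma$. It is topologically weakly mixing if $(X\times X,T\times T)$ is transitive, i.e. for all non-empty open $U,V\subset X\times X$ there is $g\in G$ with $U\cap (T\times T)^gV\ne\emptyset$. A factor of $(X,T)$ is a $G$-topological dynamical system $(Y,S)$ for which there is a continuous surjective $G$-equivariant map $X\to Y$; it is non-trivial if $Y$ has more than one point. $(X,T)$ has topological CPE if every non-trivial factor has positive topological entropy. For a subshift $X$ and a finite $F\subset G$, $L_F(X)=\{x|_F: x\in X\}$ is the set of patterns of $X$ with support $F$. A pair $(x,y)\in X^2$ is asymptotic if $x$ and $y$ agree outside a finite subset of $G$. Patterns $p,q\in L_F(X)$ are exchangeable if there is an asymptotic pair $(x,y)\in X^2$ with $x|_F=p$ and $y|_F=q$. They are $n$-chain exchangeable if there are patterns $r_0,\dots,r_n\in\mathcal A^F$ with $p=r_0$, $q=r_n$ and $r_{i-1},r_i$ exchangeable for every $i\in\{1,\dots,n\}$. $X$ has BCE if there is $N\in\mathbb{N}$ such that for every finite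 $F\subset G$ every pair $p,q\in L_F(X)$ is $N$-chain exchangeable. *)

(* Defs.v *)
From HB Require Import structures.
From mathcomp Require Import all_boot all_order all_algebra finmap.
From mathcomp Require Import all_classical all_reals all_analysis.

Set Implicit Arguments.
Unset Strict Implicit.
Unset Printing Implicit Defensive.

Import Order.TTheory GRing.Theory Num.Theory.
Import numFieldNormedType.Exports.

Local Open Scope classical_set_scope.
Local Open Scope ring_scope.

Notation Z3 := 'rV[int]_3.

Record tds (R : realType) := TDS {
  tds_space :> metricType R;
  tds_act : Z3 -> tds_space -> tds_space;
  tds_compact : compact [set: tds_space];
  tds_act0 : forall y, tds_act 0 y = y;
  tds_actD : forall g h y, tds_act (g + h) y = tds_act g (tds_act h y);
  tds_act_continuous : forall g, continuous (tds_act g) }.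

(* The notions below only involve the topology, so they are stated for a
   family of self-maps of a topological space; they are used for compact
   metrizable spaces acted upon by Z^3. *)

Definition transitive_act (X : topologicalType) (T : Z3 -> X -> X) :=
  forall U V : set X, open U -> open V -> U !=set0 -> V !=set0 ->
    exists g, U `&` T g @` V !=set0.

Definition prod_act (X : Type) (T : Z3 -> X -> X) (g : Z3) (p : X * X) :=
  (T g p.1, T g p.2).

Definition weakly_mixing (X : topologicalType) (T : Z3 -> X -> X) :=
  transitive_act (prod_act T).

Definition is_factor (R : realType) (X : topologicalType) (T : Z3 -> X -> X)
    (Y : tds R) :=
  exists f : X -> Y, [/\ continuous f, range f = setT &
    forall g x, f (T g x) = tds_act g (f x)].

Definition nontrivial (Y : Type) := exists y y' : Y, y <> y'.

Definition open_cover (X : topologicalType) (U : set (set X)) :=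
  (forall A, U A -> open A) /\ \bigcup_(A in U) A = setT.

(* [U] has a subcover with at most [n] elements. *)
Definition has_subcover (X : Type) (U : set (set X)) (n : nat) :=
  exists s : 'I_n -> set X, (forall i, U (s i)) /\ \bigcup_i s i = setT.

(* The minimal cardinality of a subcover (0 if no subcover is finite, which
   does not happen for open covers of compact spaces). *)
Definition cover_number (X : Type) (U : set (set X)) : nat :=
  xget 0%N [set n | has_subcover U n /\
                    forall m, has_subcover U m -> (n <= m)%N].

Definition cube (n : nat) : set Z3 :=
  [set g | forall i : 'I_3, (0 <= g ord0 i) && (g ord0 i < n%:Z)].

(* The common refinement of the covers T_g^-1 U for g in F. *)
Definition join_cover (X : Type) (T : Z3 -> X -> X) (F : set Z3)
    (U : set (set X)) : set (set X) :=
  [set \bigcap_(g in F) (T g @^-1` phi g) |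
    phi in [set phi : Z3 -> set X | forall g, F g -> U (phi g)]].

(* Adler-Konheim-McAndrew entropy, along the Folner sequence of the cubes
   [0, n)^3; the limit exists by subadditivity. *)
Definition cover_entropy (R : realType) (X : Type) (T : Z3 -> X -> X)
    (U : set (set X)) : R :=
  limn (fun n : nat =>
    ln (cover_number (join_cover T (cube n) U))%:R / (n ^ 3)%:R : R).

Definition top_entropy (R : realType) (X : topologicalType)
    (T : Z3 -> X -> X) : \bar R :=
  ereal_sup [set (cover_entropy R T U)%:E | U in @open_cover X].

Definition top_CPE (R : realType) (X : topologicalType) (T : Z3 -> X -> X) :=
  forall Y : tds R, is_factor T Y -> nontrivial Y ->
    (0 < top_entropy R (@tds_act R Y))%E.

Definition config (A : finType) := {ptws Z3 -> discrete_topology A}.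

Definition shift (A : finType) (g : Z3) (x : config A) : config A :=
  fun h => x (- g + h).

Record subshift (A : finType) := Subshift {
  subshift_set : set (config A);
  subshift_closed : closed subshift_set;
  subshift_invariant : forall g x, subshift_set x -> subshift_set (shift g x) }.

(* [set_type] carries the topology induced by that of [config A]. *)
Definition points (A : finType) (X : subshift A) : topologicalType :=
  set_type (subshift_set X).

Definition subshift_act (A : finType) (X : subshift A) (g : Z3)
    (x : points X) : points X :=
  SigSub (mem_set (subshift_invariant g (set_valP x))).

Definition pattern (A : finType) (F : {fset Z3}) := {ffun F -> A}.

Definition restrict (A : finType) (F : {fset Z3}) (x : config A) :
  pattern A F := [ffun h : F => x (val h)].

Definition appears (A : finType) (F : {fset Z3}) (p : pattern A F)
    (x : config A) := exists g, restrict F (shift g x) = p.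

Definition is_SFT (A : finType) (X : subshift A) :=
  exists forbidden : set {F : {fset Z3} & pattern A F},
    finite_set forbidden /\
    subshift_set X = [set x | forall p, forbidden p -> ~ appears (projT2 p) x].

Definition language (A : finType) (X : subshift A) (F : {fset Z3}) :
  set (pattern A F) := [set restrict F x | x in subshift_set X].
Arguments language {A} X F.

Definition asymptotic (A : finType) (x y : config A) :=
  finite_set [set g | x g <> y g].

Definition exchangeable (A : finType) (X : subshift A) (F : {fset Z3})
    (p q : pattern A F) :=
  exists x y : config A, [/\ subshift_set X x, subshift_set X y, asymptotic x y,
    restrict F x = p & restrict F y = q].

Definition chain_exchangeable (A : finType) (X : subshift A) (n : nat)
    (F : {fset Z3}) (p q : pattern A F) :=
  exists r : nat -> pattern A F, [/\ r 0%N = p, r n = q &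
    forall i, (i < n)%N -> exchangeable X (r i) (r i.+1)].

Definition BCE (A : finType) (X : subshift A) :=
  exists N : nat, forall (F : {fset Z3}) (p q : pattern A F),
    language X F p -> language X F q -> chain_exchangeable X N p q.

(* Main.v *)
Require Import Defs.
From mathcomp Require Import all_boot all_order all_algebra finmap zify lra.
From mathcomp Require Import all_classical all_reals all_analysis.

(** The subshift has alphabet {0,1}. Call the restriction of a configuration
    to a line (Z, b, c) the row (b, c), and say that it jumps at a when it
    takes different values at a and a + 1. The local rule is that above a jump
    of row (b, c) the row (b + 1, c) is 1 and the row (b + 2, c) is 0, at both
    ends a and a + 1 of the jump.

    If adjacent rows b and b + 1 both jumped, row b + 2 would be 0 at the first
    jump and 1 at the second, hence jump strictly between them; the same
    argument applies to rows b + 1 and b + 2, and infinite descent on the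
    distance gives a contradiction (no_adjacent_jumps). So a row above a row
    that jumps is constantly 1 (row_above_jump).

    BCE fails. If x and y are asymptotic and differ on a row, one of them jumps
    there, and the row above is constantly 1 in both
    (asymptotic_row_above). Thus one exchange changes a row only if the row
    above is already 1, so the ones of a vertical segment of length N + 1,
    starting from all zeros, spread downwards by at most one step per exchange,
    and N exchanges do not lead from all zeros to all ones (not_BCE).

    Weak mixing. The rule does not relate different values of c, so layers of
    two configurations can be combined arbitrarily (cascade_mixing).

    Topological CPE. Let f be a factor map onto a system without positive
    entropy.
    - f identifies asymptotic points x and y (asymptotic_factor). Any pattern
      of x on a box reappears along a lattice in a configuration of the subshift
      (tile), and each copy may be replaced by that of y independently of the
      others (transplant). If f separated x and y, a two-set cover separating
      neighbourhoods of their images would need at least 2 ^ (t ^ 3) members of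
      its refinement over a cube of side p * t. As the limit defining the
      entropy exists (rate_cvg), the entropy would be positive.
    - f identifies limits of identified pairs (same_closed), which reaches all
      pairs. Every point is a limit of points asymptotic to configurations with
      constant rows, all but finitely many of them 1 (same_ones). The topmost
      rows equal to 0 can be raised to 1: on larger and larger intervals, each
      time as an exchange between configurations with a pyramid of ones in every
      second row above (raise_row). After finitely many raisings all rows are 1.
    Hence the factor is a single point. The number of raisings depends on the
    point, and this is what leaves room for the failure of BCE. *)

Import Defs.

Set Implicit Arguments.
Unset Strict Implicit.
Unset Printing Implicit Defensive.

Import Order.TTheory GRing.Theory Num.Theory.
Import numFieldNormedType.Exports.

Local Open Scope classical_set_scope.
Local Open Scope ring_scope.

Implicit Types (u v : int -> int -> int -> bool) (a b c : int).

(** * The local rule and its rigidity *)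

Definition jump u a b c := u a b c != u (a + 1) b c.

Definition facilitated u := forall a b c, jump u a b c ->
  [/\ u a (b + 1) c, u (a + 1) (b + 1) c,
      ~~ u a (b + 2) c & ~~ u (a + 1) (b + 2) c].

Lemma change_between (f : int -> bool) (a a' : int) :
  a <= a' -> f a != f a' -> exists2 t, a <= t < a' & f t != f (t + 1).
Proof.
move=> le_aa'; have -> : a' = a + (absz (a' - a)%R)%:Z by lia.
elim: (absz _)%N => {le_aa'} [|n IHn]; first by rewrite addr0 eqxx.
have [eq_f|ne_f _] := eqVneq (f a) (f (a + n%:Z)); last first.
  by have [t t_in ft] := IHn ne_f; exists t => //; lia.
rewrite eq_f => ne_f; exists (a + n%:Z); first lia.
by have -> : a + n%:Z + 1 = a + n.+1%:Z by lia.
Qed.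

Lemma row_change u a a' b c : u a b c != u a' b c -> exists t, jump u t b c.
Proof.
case: (leP a a') => [le_aa' | /ltW le_a'a] ne_u.
  have [t _ jt] := change_between (f := fun a => u a b c) le_aa' ne_u.
  by exists t.
rewrite eq_sym in ne_u.
have [t _ jt] := change_between (f := fun a => u a b c) le_a'a ne_u.
by exists t.
Qed.

(** The two jumps force different values of row b + 2, which therefore jumps
    strictly between them: rows b + 1 and b + 2 are then a closer bad pair. *)
Lemma no_adjacent_jumps u a a' b c :
  facilitated u -> jump u a b c -> jump u a' (b + 1) c -> False.
Proof.
move=> fu; move: {2}(absz _).+1 (ltnSn (absz (a - a'))) => n.
elim: n => // n IHn in a a' b *; rewrite ltnS => dist_n ja ja'.
have [_ _ u1 u2] := fu _ _ _ ja; have := fu _ _ _ ja'.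
have -> : b + 1 + 1 = b + 2 by lia.
move=> [u3 u4 _ _].
have [t t_in jt] : exists2 t,
    (Num.min a a' < t < Num.max a a') & jump u t (b + 2) c.
  have [lt_aa'|lt_a'a|eq_aa'] := ltgtP a a'; last first.
  - by rewrite eq_aa' u3 in u1.
  - have [||t t_in jt] := @change_between (fun t => u t (b + 2) c) (a' + 1) a.
    + by lia.
    + by rewrite u4 (negbTE u1).
    + by exists t => //; lia.
  - have [||t t_in jt] := @change_between (fun t => u t (b + 2) c) (a + 1) a'.
    + by lia.
    + by rewrite u3 (negbTE u2).
    + by exists t => //; lia.
by apply: (IHn a' t (b + 1)) => //; [lia | have -> : b + 1 + 1 = b + 2 by lia].
Qed.

Lemma row_above_jump u a b c : facilitated u -> jump u a b c ->
  forall a', u a' (b + 1) c.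
Proof.
move=> fu ja a'; apply: contraT => ua'; have [ua _ _ _] := fu _ _ _ ja.
have [|t jt] := @row_change u a a' (b + 1) c; first by rewrite ua (negbTE ua').
by case: (no_adjacent_jumps fu ja jt).
Qed.

(** Only the case where v, but not u, jumps in row b is not immediate. If u had
    a 0 in row b + 1, then, both configurations agreeing far to the right, v
    would jump in row b + 2 and u would have a 0 in row b + 3; climbing in
    steps of two, the same would hold at heights where u and v coincide. *)
Lemma asymptotic_row_above u v (m a b c : int) :
  facilitated u -> facilitated v ->
  (forall a b, u a b c != v a b c -> a < m /\ b < m) ->
  u a b c != v a b c -> forall a', u a' (b + 1) c.
Proof.
move=> fu fv close ne_uv a'; apply: contraT => ua'.
have far b' : u m b' c = v m b' c.
  by apply/eqP; apply: contraT => /close [] /=; rewrite ltxx.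
have ladder n : (exists t, jump v t (b + 2 * n%:Z) c) /\
    exists a', ~~ u a' (b + 1 + 2 * n%:Z) c.
  elim: n => [|n [[t jt] [s us]]].
    rewrite mulr0 !addr0; split; last by exists a'.
    have [eq_u|ne_u] := eqVneq (u a b c) (u m b c).
      by apply: (@row_change v a m); rewrite -far -eq_u eq_sym.
    have [t jt] := row_change ne_u.
    by rewrite (row_above_jump fu jt) in ua'.
  set b1 := b + 2 * n%:Z in jt; have eb : b + 1 + 2 * n%:Z = b1 + 1 by lia.
  have -> : b + 2 * n.+1%:Z = b1 + 2 by lia.
  have -> : b + 1 + 2 * n.+1%:Z = b1 + 1 + 2 by lia.
  rewrite eb in us; have v_full := row_above_jump fv jt.
  have [r jr] : exists r, jump u r (b1 + 1) c.
    by apply: (@row_change u m s); rewrite far v_full (negbTE us).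
  have [_ _ ur _] := fu _ _ _ jr.
  split; last by exists r.
  have [_ _ vt _] := fv _ _ _ jt; apply: (@row_change v m t).
  have := row_above_jump fu jr m; have -> : b1 + 1 + 1 = b1 + 2 by lia.
  by rewrite far => ->; rewrite (negbTE vt).
have [[t jt] [s us]] := ladder (absz (m - b)%R).
set b1 := b + _ in jt.
have eb : b + 1 + 2 * (absz (m - b)%R)%:Z = b1 + 1 by lia.
have high a1 : u a1 b1 c = v a1 b1 c.
  by apply/eqP; apply: contraT => /close []; lia.
rewrite eb (row_above_jump (a := t) fu) // in us.
by rewrite /jump !high.
Qed.

(** Folding the a-axis by a 1-Lipschitz map creates no new kind of jump; reading
    a jump backwards is harmless because the rule constrains both of its ends.
    Constant rows may be followed by anything. *)
Lemma facilitated_comp u (f g h : int -> int) :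
  facilitated u ->
  (forall a, f (a + 1) = f a \/ f (a + 1) = f a + 1 \/ f (a + 1) = f a - 1) ->
  (forall b, (forall a c, u a (g b) c = u 0 (g b) c) \/
     (g (b + 1) = g b + 1 /\ g (b + 2) = g b + 2)) ->
  facilitated (fun a b c => u (f a) (g b) (h c)).
Proof.
move=> fu f_lip g_step a b c; rewrite /jump.
case: (g_step b) => [const|[-> ->]]; first by rewrite !(const (f _)) eqxx.
case: (f_lip a) => [->|[->|->]]; first by rewrite eqxx.
  exact: fu.
have := fu (f a - 1) (g b) (h c); rewrite /jump subrK eq_sym => H /H.
by case.
Qed.

(** * Truncated, periodic and pyramidal configurations *)

Section Modifications.
Implicit Types n m k R q : int.

(** Outside the box, the rows are made constant. The row n + 1 has to be 1 if
    row n jumps, and has to have zeros if row n - 1 jumps, which excludes that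
    row n jumps; row n + 2 has to be 0 if row n jumps. The other rows are 1, so
    that only finitely many rows contain zeros. *)
Definition truncate u (n : int) a b c : bool :=
  if `|c| <= n then
    if `|b| <= n then u a b c
    else if b == n + 1 then `[< exists t, jump u t n c >]
    else b != n + 2
  else true.

Lemma truncate_inside u n a b c :
  `|b| <= n -> `|c| <= n -> truncate u n a b c = u a b c.
Proof. by move=> bn cn; rewrite /truncate cn bn. Qed.

Lemma truncate_row u n a a' b c :
  n < `|b| -> truncate u n a b c = truncate u n a' b c.
Proof.
by move=> bn; rewrite /truncate; have -> : (`|b| <= n) = false by lia.
Qed.

Lemma truncate_outside u n a b c :
  n < `|c| \/ n + 2 < `|b| -> truncate u n a b c.
Proof.
rewrite /truncate; case: ifP => // cn bn; have {}bn : n + 2 < `|b| by lia.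
by rewrite ifF ?ifF; lia.
Qed.

Lemma facilitated_truncate u (n : int) :
  0 <= n -> facilitated u -> facilitated (truncate u n).
Proof.
move=> n_ge0 fu a b c; rewrite /jump.
have [bn|bn] := leP `|b| n; last by rewrite (truncate_row _ a (a + 1)) ?eqxx.
have [cn|cn] := leP `|c| n; last by rewrite !truncate_outside; [| lia..].
rewrite !(truncate_inside _ _ bn cn) => ju; have [u1 u2 u3 u4] := fu _ _ _ ju.
rewrite /truncate cn.
have [b_in|b_out] := leP (b + 2) n.
  have -> : `|b + 1| <= n by lia.
  by have -> : `|b + 2| <= n by lia.
have [eb|eb] : b = n \/ b = n - 1 by lia.
- have -> : (`|b + 1| <= n) = false by lia.
  have -> : (`|b + 2| <= n) = false by lia.
  have -> : b + 1 == n + 1 by lia.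
  have -> : (b + 2 == n + 1) = false by lia.
  by rewrite eb eqxx; split=> //; apply/asboolP; exists a; rewrite -eb.
- have -> : (`|b + 1| <= n) by lia.
  have -> : (`|b + 2| <= n) = false by lia.
  have -> : b + 2 == n + 1 by lia.
  split=> //; apply/asboolP => -[t jt];
    apply: (no_adjacent_jumps fu ju (a' := t));
    by have -> : b + 1 = n by lia.
Qed.

(** A 1-Lipschitz map that is the identity on [-n, n] and 0 far away: pulling
    back along it makes each row equal to its value at 0 near infinity. *)
Definition bump_map (n a : int) : int :=
  if `|a| <= n then a
  else if 0 <= a then Num.max (2 * n - a) 0 else Num.min (- 2 * n - a) 0.

Lemma bump_map_lip n a : 0 <= n ->
  bump_map n (a + 1) = bump_map n a \/
  bump_map n (a + 1) = bump_map n a + 1 \/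
  bump_map n (a + 1) = bump_map n a - 1.
Proof. by rewrite /bump_map; do !case: ifP; lia. Qed.

Lemma bump_map_far n a : 0 <= n -> 2 * n <= `|a| -> bump_map n a = 0.
Proof. by rewrite /bump_map; do !case: ifP; lia. Qed.

(** One period holds a copy of [-n, n] and its mirror image. *)
Definition period (n : int) : int := 4 * n + 2.
Definition offset (n a : int) : int := ((a + n) %% period n)%Z - n.
Definition cell (n a : int) : int := ((a + n) %/ period n)%Z.
(** The triangle wave: periodic, 1-Lipschitz, the identity on [-n, n]. *)
Definition wave (n a : int) : int :=
  if offset n a <= n then offset n a else 2 * n + 1 - offset n a.

Lemma cell_offset n a : a = cell n a * period n + offset n a.
Proof. by rewrite /cell /offset addrA -divz_eq addrK. Qed.

Lemma offset_bounds n a : 0 <= n -> - n <= offset n a <= 3 * n + 1.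
Proof.
move=> n_ge0; have p_gt0 : period n != 0 by rewrite /period; lia.
have := modz_ge0 (a + n) p_gt0; have := ltz_mod (a + n) p_gt0.
rewrite /offset; move: (_ %% _)%Z => r; rewrite /period; lia.
Qed.

Lemma offset_unique n a q r : 0 <= n -> - n <= r <= 3 * n + 1 ->
  a = q * period n + r -> cell n a = q /\ offset n a = r.
Proof.
move=> n_ge0 r_in ea; have p_gt0 : 0 < period n by rewrite /period; lia.
rewrite /cell /offset ea -addrA divzMDl ?lt0r_neq0 // modzMDl.
have small : 0 <= r + n < `|period n| by rewrite /period; lia.
by rewrite divz_small // modz_small ?addr0 ?addrK //; rewrite /period; lia.
Qed.

Lemma offsetD n a i : 0 <= n -> - n <= offset n a + i <= 3 * n + 1 ->
  cell n (a + i) = cell n a /\ offset n (a + i) = offset n a + i.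
Proof.
move=> n_ge0 r_in; apply: offset_unique => //.
by have := cell_offset n a; lia.
Qed.

Lemma offset_cell n q r : 0 <= n -> `|r| <= n ->
  cell n (q * period n + r) = q /\ offset n (q * period n + r) = r.
Proof. by move=> n_ge0 rn; apply: offset_unique => //; lia. Qed.

Lemma wave_lip n a : 0 <= n ->
  wave n (a + 1) = wave n a \/ wave n (a + 1) = wave n a + 1 \/
  wave n (a + 1) = wave n a - 1.
Proof.
move=> n_ge0; rewrite /wave; have := offset_bounds a n_ge0.
have [a_last|a_last] := eqVneq (offset n a) (3 * n + 1).
  have [||_ ->] := @offset_unique n (a + 1) (cell n a + 1) (- n) n_ge0.
  - by lia.
  - have := cell_offset n a; rewrite a_last (mulrDl (cell n a)) mul1r.
    by move: (cell n a * period n) => p; rewrite /period; lia.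
  by do !case: ifP; lia.
move=> ra; have [_ ->] := @offsetD n a 1 n_ge0 ltac:(lia).
by do !case: ifP; lia.
Qed.

Lemma wave_inside n a : `|offset n a| <= n -> wave n a = offset n a.
Proof. by rewrite /wave => an; rewrite ifT //; lia. Qed.

(** A periodic configuration repeating the box pattern of u: the a-axis is
    folded to avoid jumps at the seams, while in the other directions the
    constant rows of the truncation separate the copies. *)
Definition tile u n a b c := truncate u n (wave n a) (offset n b) (offset n c).

Lemma tile_inside u n a b c : `|offset n a| <= n -> `|offset n b| <= n ->
  `|offset n c| <= n ->
  tile u n a b c = u (offset n a) (offset n b) (offset n c).
Proof. by move=> an bn cn; rewrite /tile truncate_inside // wave_inside. Qed.

Lemma facilitated_tile u n : 1 <= n -> facilitated u -> facilitated (tile u n).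
Proof.
move=> n_ge1 fu; have n_ge0 : 0 <= n by lia.
apply: facilitated_comp (facilitated_truncate _ fu) _ _ => // [a|b].
  exact: wave_lip.
have [bn|bn] := leP `|offset n b| n; last first.
  by left=> a c; apply: truncate_row.
by right; split; apply: (offsetD _ _).2; lia.
Qed.

(** The copies with index in E receive the central box of v in place of that
    of u. *)
Definition transplant u v (E : int -> int -> int -> bool) (m n : int) a b c :=
  if [&& E (cell n a) (cell n b) (cell n c), `|offset n a| <= m,
         `|offset n b| <= m & `|offset n c| <= m]
  then v (offset n a) (offset n b) (offset n c) else tile u n a b c.

Lemma transplant_inside u v E m n a b c :
  (forall a b c, u a b c != v a b c -> [&& `|a| <= m, `|b| <= m & `|c| <= m]) ->
  `|offset n a| <= n -> `|offset n b| <= n -> `|offset n c| <= n ->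
  transplant u v E m n a b c =
  (if E (cell n a) (cell n b) (cell n c) then v else u)
    (offset n a) (offset n b) (offset n c).
Proof.
move=> close an bn cn; rewrite /transplant tile_inside //.
case: (E _ _ _) => //=; case: ifPn => // far.
by apply/eqP; apply: contraNT far => /close.
Qed.

(** The sites involved in one instance of the rule either lie in a single copy,
    where u or v is seen, or avoid all central boxes, where nothing changed. *)
Lemma facilitated_transplant u v E (m n : int) :
  0 <= m -> m + 2 <= n -> facilitated u -> facilitated v ->
  (forall a b c, u a b c != v a b c -> [&& `|a| <= m, `|b| <= m & `|c| <= m]) ->
  facilitated (transplant u v E m n).
Proof.
move=> m_ge0 mn fu fv close a b c; have n_ge0 : 0 <= n by lia.
have [near|far] := boolP [&& - m - 1 <= offset n a <= m,
                         - m - 2 <= offset n b <= m & `|offset n c| <= m].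
  have [ca wa] := @offsetD n a 1 n_ge0 ltac:(lia).
  have [cb wb] := @offsetD n b 1 n_ge0 ltac:(lia).
  have [cb2 wb2] := @offsetD n b 2 n_ge0 ltac:(lia).
  rewrite /jump !transplant_inside ?wa ?wb ?wb2 //; try lia.
  rewrite ca cb cb2.
  case: (E _ _ _); [exact: fv | exact: fu].
have outside i j : (i == 0) || (i == 1) -> (j == 0) || (j == 1) || (j == 2) ->
    transplant u v E m n (a + i) (b + j) c = tile u n (a + i) (b + j) c.
  move=> i01 j012; rewrite /transplant ifN //; apply: contra far.
  move=> /and4P[_ ai bj ->].
  have [_ wa] := @offsetD n (a + i) (- i) n_ge0 ltac:(lia).
  have [_ wb] := @offsetD n (b + j) (- j) n_ge0 ltac:(lia).
  move: wa wb; rewrite !addrK => -> ->; lia.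
have := @facilitated_tile u n ltac:(lia) fu a b c; rewrite /jump.
have := outside 0 0; rewrite !addr0 => -> //.
have := outside 1 0; rewrite !addr0 => -> //.
have := outside 0 1; rewrite !addr0 => -> //.
have := outside 0 2; rewrite !addr0 => -> //.
by rewrite (outside 1 1) // (outside 1 2).
Qed.

(** In the layers of S, the rows k, k + 2, k + 4, ... carry intervals of ones
    that shrink by one at each end from one row to the next, so that the ends
    of each interval see zeros two rows above. *)
Definition pyramid (r : int -> int -> bool) (S : int -> bool) k R a b c :=
  if [&& S c, k <= b & ~~ odd (absz (b - k)%R)]
  then 2 * `|a| + (b - k) < 2 * R else r b c.

Lemma facilitated_pyramid (r : int -> int -> bool) (S : int -> bool) k R :
  (forall b c, k < b -> r b c) -> facilitated (pyramid r S k R).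
Proof.
move=> above a b c; rewrite /jump /pyramid.
case: ifPn => [/and3P[Sc kb even_b]|]; last by rewrite eqxx.
have -> : [&& S c, k <= b + 1 & ~~ odd `|(b + 1 - k)%R|] = false by lia.
have -> : [&& S c, k <= b + 2 & ~~ odd `|(b + 2 - k)%R|] by lia.
by move=> ju; split; try apply: above; lia.
Qed.

End Modifications.

(** * The subshift and its topology *)

Implicit Types (x y z : config bool).

Definition ix : 'I_3 := @Ordinal 3 0 isT.
Definition iy : 'I_3 := @Ordinal 3 1 isT.
Definition iz : 'I_3 := @Ordinal 3 2 isT.

Definition pt (a b c : int) : Z3 := \row_(j < 3) [:: a; b; c]`_j.

Lemma pt_x a b c : pt a b c ord0 ix = a. Proof. by rewrite mxE. Qed.
Lemma pt_y a b c : pt a b c ord0 iy = b. Proof. by rewrite mxE. Qed.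
Lemma pt_z a b c : pt a b c ord0 iz = c. Proof. by rewrite mxE. Qed.
Definition ptE := (pt_x, pt_y, pt_z).

Lemma pt_eta (g : Z3) : g = pt (g ord0 ix) (g ord0 iy) (g ord0 iz).
Proof.
apply/rowP => -[[|[|[|//]]] lt_i3]; rewrite mxE /=;
  by congr (g _ _); apply: val_inj.
Qed.

Lemma ptD a b c a' b' c' :
  pt a b c + pt a' b' c' = pt (a + a') (b + b') (c + c').
Proof. by rewrite [LHS]pt_eta !mxE. Qed.

Lemma ptN a b c : - pt a b c = pt (- a) (- b) (- c).
Proof. by rewrite [LHS]pt_eta !mxE. Qed.

Definition array (x : config bool) (a b c : int) : bool := x (pt a b c).
Definition of_array (u : int -> int -> int -> bool) : config bool :=
  fun g => u (g ord0 ix) (g ord0 iy) (g ord0 iz).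

Lemma of_arrayK u : array (of_array u) = u.
Proof.
apply/funext => a; apply/funext => b; apply/funext => c.
by rewrite /array /of_array !ptE.
Qed.

Lemma array_shift a0 b0 c0 x a b c :
  array (shift (pt a0 b0 c0) x) a b c = array x (a - a0) (b - b0) (c - c0).
Proof. by rewrite /array /shift ptN ptD !(addrC (- _)). Qed.

Definition agree (n : nat) (x y : config bool) := forall a b c : int,
  `|a| <= n%:Z -> `|b| <= n%:Z -> `|c| <= n%:Z -> array x a b c = array y a b c.

Lemma agree_le m n x y : (m <= n)%N -> agree n x y -> agree m x y.
Proof. by move=> mn xy a b c am bm cm; apply: xy; lia. Qed.

Lemma nbhs_agree n (x : config bool) : nbhs x [set y | agree n x y].
Proof.
pose e (i : 'I_(2 * n + 1)) : int := (i : nat)%:Z - n%:Z.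
pose g (ijk : 'I_(2 * n + 1) * 'I_(2 * n + 1) * 'I_(2 * n + 1)) :=
  pt (e ijk.1.1) (e ijk.1.2) (e ijk.2).
suff : \forall y \near x, forall ijk, y (g ijk) = x (g ijk).
  apply: filterS => y xy a b c an bn cn.
  have ex_e (d : int) : `|d| <= n%:Z -> exists i, d = e i.
    move=> dn; have lt_d : (absz (d + n%:Z)%R < 2 * n + 1)%N by lia.
    by exists (Ordinal lt_d); rewrite /e /=; lia.
  have [[[i ->] [j ->]] [k ->]] := ((ex_e _ an, ex_e _ bn), ex_e _ cn).
  exact: esym (xy (i, j, k)).
apply: (@filter_forall _ _ (fun ijk y => y (g ijk) = x (g ijk))
  (nbhs x) (nbhs_filter x)) => ijk.
have := @proj_continuous Z3 (fun=> discrete_topology bool) (g ijk) x.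
by move=> /(_ _ (discrete_set1 (x (g ijk)))).
Qed.

(** The sets containing all configurations that agree with x on some box form a
    filter; its images under the coordinate maps converge, so it converges to x
    and contains the neighbourhoods of x. *)
Lemma agree_nbhs (x : config bool) (U : set (config bool)) :
  nbhs x U -> exists n, forall y, agree n x y -> U y.
Proof.
pose G := [set A : set (config bool) | exists n, forall y, agree n x y -> A y].
have GF : Filter G.
  split=> [|A B [m mA] [n nB]|A B AB [n nA]]; first by exists 0%N.
    exists (maxn m n) => y xy; split; [apply: mA|apply: nB];
      by apply: agree_le xy; rewrite (leq_maxl, leq_maxr).
  by exists n => y /nA /AB.
suff Gx : cvg_to G (nbhs x) by exact: Gx.
apply: (@cvg_sup _ _ (fun g => Topological.class (initial_topology
  (fun f : Z3 -> discrete_topology bool => f g))) G x GF).2 => g A.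
rewrite nbhsE => -[B [[C _ BC] Bx] BA].
exists (\max_(i < 3) absz (g ord0 i))%N => y xy; apply: BA.
rewrite -BC /= in Bx *; suff -> : y g = x g by [].
rewrite [g]pt_eta; apply/esym/xy; rewrite -abszE lez_nat;
  exact: (@leq_bigmax _ (fun i : 'I_3 => absz (g ord0 i))).
Qed.

Definition valid : set (config bool) := [set x | facilitated (array x)].

Lemma valid_closed : closed valid.
Proof.
move=> x clx a b c.
have [y [vy xy]] :=
  clx _ (@nbhs_agree (absz a + absz b + absz c + 2)%N x).
have := vy a b c; rewrite /jump.
by rewrite -!xy; [exact | lia..].
Qed.

Lemma valid_shift g x : valid x -> valid (shift g x).
Proof.
rewrite [g]pt_eta => vx a b c; rewrite /jump !array_shift.
rewrite (addrAC a 1) (addrAC b 1) (addrAC b 2).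
exact: vx.
Qed.

Definition cascade : subshift bool := Subshift valid_closed valid_shift.

(** * Finite type *)

Lemma restrictP F x y :
  restrict F x = restrict F y <-> (forall g, g \in F -> x g = y g).
Proof.
split=> [/ffunP xy g gF|xy].
  by have := xy (FSetSub gF); rewrite !ffunE.
by apply/ffunP => g; rewrite !ffunE; apply: xy; exact: valP.
Qed.

Definition window : {fset Z3} :=
  [fset pt 0 0 0; pt 1 0 0; pt 0 1 0; pt 1 1 0; pt 0 2 0; pt 1 2 0]%fset.

(** The instance of the local rule at the origin. *)
Definition valid0 x := jump (array x) 0 0 0 ->
  [/\ array x 0 1 0, array x 1 1 0, ~~ array x 0 2 0 & ~~ array x 1 2 0].

Lemma validP x : valid x <-> forall g, valid0 (shift g x).
Proof.
split=> [vx g|vx a b c].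
  have := valid_shift (g := g) vx (a := 0) (b := 0) (c := 0).
  by rewrite /jump !add0r.
have := vx (pt (- a) (- b) (- c)); rewrite /valid0 /jump !array_shift !opprK.
by rewrite !add0r ![1 + _]addrC ![2 + _]addrC.
Qed.

Lemma cascade_SFT : is_SFT cascade.
Proof.
exists [set existT (fun F => pattern bool F) window p | p in
  [set p | ~ exists2 y, valid0 y & restrict window y = p]].
split; first exact/finite_image/finite_finset.
apply/seteqP; split=> x.
  move=> /validP vx _ [p p_bad <-] [g gp]; apply: p_bad.
  by exists (shift g x).
move=> no_bad; apply/validP => g.
have [y vy /restrictP xy] : exists2 y, valid0 y & restrict window y =
    restrict window (shift g x).
  apply: contrapT => bad.
  apply: (no_bad (existT (fun F => pattern bool F) window
    (restrict window (shift g x)))); last by exists g.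
  by exists (restrict window (shift g x)).
have in_window i j : (i == 0) || (i == 1) -> [|| j == 0, j == 1 | j == 2] ->
    array y i j 0 = array (shift g x) i j 0.
  move=> i01 j012; apply: xy; rewrite !inE.
  by case/orP: i01 => /eqP ->; case/or3P: j012 => /eqP ->; rewrite eqxx ?orbT.
by move: vy; rewrite /valid0 /jump !add0r !in_window.
Qed.

(** * Failure of bounded chain exchangeability *)

Lemma asymptotic_bound x y : asymptotic x y ->
  exists m : int, forall a b c, array x a b c != array y a b c ->
    [&& `|a| <= m, `|b| <= m & `|c| <= m].
Proof.
case/finite_fsetP => D eD.
exists (\sum_(g <- D) \sum_(i < 3) `|g ord0 i|) => a b c ne_xy.
have gD : pt a b c \in D.
  have : [set` D] (pt a b c) by rewrite -eD; apply/eqP.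
  by [].
have le_i (i : 'I_3) : `|pt a b c ord0 i| <=
    \sum_(g <- D) \sum_(i < 3) `|g ord0 i|.
  rewrite (big_fsetD1 _ gD) (bigD1 i) //= -addrA lerDl.
  by rewrite addr_ge0 // ?sumr_ge0 // => ? _; apply: sumr_ge0 => ? _.
by have := (le_i ix, le_i iy, le_i iz); rewrite !ptE => -[[-> ->] ->].
Qed.

Lemma valid_const (e : bool) : valid (of_array (fun _ _ _ => e)).
Proof. by move=> a b c; rewrite /jump of_arrayK eqxx. Qed.

(** An exchange can turn a 0 of the segment into a 1 only below a 1, so after n
    exchanges from the zero pattern only the n topmost sites may be 1. *)
Lemma not_BCE : ~ BCE cascade.
Proof.
case=> N chain.
pose F : {fset Z3} := seq_fset tt [seq pt 0 i%:Z 0 | i <- iota 0 N.+1].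
have in_F i : (i <= N)%N -> pt 0 i%:Z 0 \in F.
  by move=> iN; rewrite seq_fsetE; apply/mapP; exists i; rewrite ?mem_iota.
pose const e := of_array (fun _ _ _ => e).
have [||r [r0 rN step]] :=
  chain F (restrict F (const false)) (restrict F (const true)).
- by exists (const false) => //; exact: valid_const.
- by exists (const true) => //; exact: valid_const.
have low n : (n <= N)%N -> forall x, restrict F x = r n ->
    forall i, (i + n <= N)%N -> array x 0 i%:Z 0 = false.
  elim: n => [_ x|n IHn lt_nN x xr i i_low].
    by rewrite r0 => /restrictP xF i i_low; apply: xF; apply: in_F; lia.
  have [y [z [vy vz yz yr zr]]] := step n lt_nN.
  have [m close] := asymptotic_bound yz.
  have /restrictP xz : restrict F x = restrict F z by rewrite xr.
  have -> : array x 0 i%:Z 0 = array z 0 i%:Z 0 by apply: xz; apply: in_F; lia.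
  have yi j : (j + n <= N)%N -> array y 0 j%:Z 0 = false.
    by move=> j_low; apply: (IHn _ _ yr) => //; exact: ltnW.
  apply/negbTE/negP => zi.
  have close0 a b : array y a b 0 != array z a b 0 -> a < m + 1 /\ b < m + 1.
    by move=> /close; lia.
  have := asymptotic_row_above vy vz close0 (a := 0) (b := i%:Z).
  rewrite yi ?zi; last lia.
  move=> /(_ isT 0); have -> : i%:Z + 1 = i.+1%:Z by lia.
  by rewrite yi //; lia.
have := low N (leqnn N) _ (esym rN) 0%N (leqnn N).
by rewrite of_arrayK.
Qed.

(** * Weak mixing *)

Definition point_of x (vx : valid x) : points cascade := SigSub (mem_set vx).

Lemma nbhs_points (p : points cascade) (A : set (points cascade)) : nbhs p A ->
  exists n, forall q : points cascade, agree n (val p) (val q) -> A q.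
Proof.
rewrite nbhsE => -[B [[C oC BC] Bp] BA].
have [|n nC] := @agree_nbhs (val p) C.
  by apply: open_nbhs_nbhs; split=> //; move: Bp; rewrite -BC.
by exists n => q /nC Cq; apply: BA; rewrite -BC.
Qed.

Lemma open_points2 (U : set (points cascade * points cascade)) p :
  open U -> U p -> exists n, forall q : points cascade * points cascade,
    agree n (val p.1) (val q.1) -> agree n (val p.2) (val q.2) -> U q.
Proof.
move=> oU Up; have [[A B] /= [nA nB] AB] : nbhs p U by exact: open_nbhs_nbhs.
have [m mA] := nbhs_points nA; have [n nB'] := nbhs_points nB.
exists (maxn m n) => q q1 q2; apply: AB; split; [apply: mA|apply: nB'].
- by apply: agree_le q1; exact: leq_maxl.
- by apply: agree_le q2; exact: leq_maxr.
Qed.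

(** The layers of x near c = 0 and, shifted by the width 2 n + 1 of this slab,
    those of y elsewhere. *)
Definition splice x y (n : int) : config bool :=
  of_array (fun a b c => if `|c| <= n then array x a b c
                         else array y a b (c - (2 * n + 1))).

Lemma valid_splice x y n : valid x -> valid y -> valid (splice x y n).
Proof.
move=> vx vy a b c; rewrite of_arrayK /jump; case: ifP => _; first exact: vx.
exact: vy.
Qed.

Lemma cascade_mixing : weakly_mixing (@subshift_act bool cascade).
Proof.
move=> U V oU oV [p Up] [q Vq].
have [m mU] := open_points2 oU Up; have [n nV] := open_points2 oV Vq.
pose k := (maxn m n)%:Z; pose g := pt 0 0 (2 * k + 1).
have vp (r : points cascade) : valid (val r) by exact: set_valP.
pose s1 := point_of (valid_splice (n := k) (vp p.1) (vp q.1)).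
pose s2 := point_of (valid_splice (n := k) (vp p.2) (vp q.2)).
have near_p (r s : points cascade) : agree m (val r) (splice (val r) (val s) k).
  by move=> a b c am bm cm; rewrite of_arrayK ifT //; lia.
have near_q (r s : points cascade) :
    agree n (val s) (shift (- g) (splice (val r) (val s) k)).
  move=> a b c am bm cm; rewrite /g ptN array_shift of_arrayK ifF; last lia.
  by congr (array _ _ _ _); lia.
exists g, (s1, s2); split; first by apply: mU; exact: near_p.
exists (subshift_act (- g) s1, subshift_act (- g) s2).
  by apply: nV; exact: near_q.
have back (s : points cascade) : subshift_act g (subshift_act (- g) s) = s.
  apply/val_inj/funext => h /=; rewrite /shift opprK.
  by rewrite addrA subrr add0r.
by rewrite /prod_act /= !back.
Qed.

(** * Entropy of covers along cubes *)

Lemma has_subcover_fin (Y : Type) (W : set (set Y)) (J : finType)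
    (s : J -> set Y) :
  (forall j, W (s j)) -> (forall y : Y, exists j, s j y) -> has_subcover W #|J|.
Proof.
move=> Ws cov; exists (fun k => s (enum_val k)); split=> //.
apply/seteqP; split=> // y _; have [j sj] := cov y.
by exists (enum_rank j); rewrite // enum_rankK.
Qed.

Lemma cover_number_spec (Y : Type) (W : set (set Y)) N : has_subcover W N ->
  has_subcover W (cover_number W) /\ (cover_number W <= N)%N.
Proof.
move=> WN; rewrite /cover_number.
case: xgetP => [n _ [Wn min_n]|no_min]; first by split=> //; exact: min_n.
have ex : exists n, `[< has_subcover W n >] by exists N; apply/asboolP.
case: (ex_minnP ex) => n /asboolP Wn min_n.
by case: (no_min n); split=> // m Wm; apply: min_n; apply/asboolP.
Qed.

Section Action.
Variables (Y : Type) (T : Z3 -> Y -> Y) (U : set (set Y)).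
Hypothesis TD : forall g h (y : Y), T (g + h) y = T g (T h y).

(** For each site of F' choose a translate of F that contains it. A choice of a
    member of the subcover for every translate then determines a member of the
    refinement over F' containing the intersection of the chosen members. *)
Lemma has_subcover_translates (F F' : set Z3) (I : finType) (t : I -> Z3) N :
  (forall h, F' h -> exists i, F (h - t i)) ->
  has_subcover (join_cover T F U) N ->
  has_subcover (join_cover T F' U) (N ^ #|I|).
Proof.
move=> F'F [s [sU s_cov]].
have /choice[phi phiP] k : exists p : Z3 -> set Y,
    (forall g, F g -> U (p g)) /\ s k = \bigcap_(g in F) (T g @^-1` p g).
  by have [p pU <-] := sU k; exists p.
have /choice[j jP] h : exists o : option I, F' h ->
    exists2 i, o = Some i & F (h - t i).
  have [F'h|nF'h] := pselect (F' h); last by exists None.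
  by have [i Fi] := F'F h F'h; exists (Some i) => _; exists i.
pose psi (f : {ffun I -> 'I_N}) h :=
  if j h is Some i then phi (f i) (h - t i) else setT.
have := @has_subcover_fin Y (join_cover T F' U) {ffun I -> 'I_N}
  (fun f => \bigcap_(h in F') (T h @^-1` psi f h)).
rewrite card_ffun card_ord; apply=> [f|y].
  exists (psi f) => // h F'h; have [i ji Fi] := jP h F'h.
  by rewrite /psi ji; apply: (phiP _).1.
have /choice[k kP] i : exists k, s k (T (t i) y).
  have : (\bigcup_i s i) (T (t i) y) by rewrite s_cov.
  by case=> k _ sk; exists k.
exists (finfun k) => h F'h /=; have [i ji Fi] := jP h F'h.
rewrite /psi ji ffunE; have := kP i; rewrite (phiP _).2 => /(_ _ Fi) /=.
by rewrite -TD subrK.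
Qed.

Lemma has_subcover_cube (m n k N : nat) : (0 < n)%N -> (m <= k * n)%N ->
  has_subcover (join_cover T (cube n) U) N ->
  has_subcover (join_cover T (cube m) U) (N ^ (k ^ 3)).
Proof.
move=> n_gt0 mkn.
pose t (i : {ffun 'I_3 -> 'I_k}) : Z3 := \row_j (n * i j)%N%:Z.
have -> : (k ^ 3)%N = #|{: {ffun 'I_3 -> 'I_k}}| by rewrite card_ffun !card_ord.
apply: (has_subcover_translates (t := t)) => h h_in.
have lt_k j : (absz (h ord0 j) %/ n < k)%N.
  rewrite ltn_divLR //; have := h_in j; lia.
exists [ffun j => Ordinal (lt_k j)] => j; rewrite !mxE ffunE /=.
have := h_in j; have := divn_eq (absz (h ord0 j)) n.
have := ltn_pmod (absz (h ord0 j)) n_gt0.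
by rewrite mulnC; lia.
Qed.

End Action.

Lemma join_cover_cube1 (Y : Type) (T : Z3 -> Y -> Y) (U : set (set Y)) N :
  (forall y : Y, T 0 y = y) -> has_subcover U N ->
  has_subcover (join_cover T (cube 1) U) N.
Proof.
move=> T0 [s [sU s_cov]].
exists (fun k => \bigcap_(g in cube 1) (T g @^-1` s k)); split=> [k|].
  by exists (fun=> s k).
apply/seteqP; split=> // y _; have : (\bigcup_i s i) y by rewrite s_cov.
case=> k _ sk; exists k => // g g1 /=; suff -> : g = 0 by rewrite T0.
by apply/rowP => j; rewrite mxE -[LHS]/(g ord0 j); have := g1 j; lia.
Qed.

(** For cover numbers C of cubes, translates of a cube of side n covering a cube
    of side m give both monotonicity and submultiplicativity in one inequality;
    it implies that the logarithms grow like the volume at an exact rate. *)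
Section Growth.
Variables (R : realType) (C : nat -> nat).
Hypothesis C_gt0 : forall n, (0 < C n)%N.
Hypothesis C_mul : forall m n k,
  (0 < n)%N -> (m <= k * n)%N -> (C m <= C n ^ (k ^ 3))%N.

Let rate (n : nat) : R := ln (C n)%:R / (n ^ 3)%:R.

Let lnC_mul m n k : (0 < n)%N -> (m <= k * n)%N ->
  ln (C m)%:R <= ln (C n)%:R * (k%:R ^+ 3) :> R.
Proof.
move=> n_gt0 mkn; rewrite -natrX mulr_natr -lnXn ?ltr0n //.
by rewrite ler_ln ?posrE ?exprn_gt0 ?ltr0n // -natrX ler_nat C_mul.
Qed.

Let rate_ge0 n : 0 <= rate n.
Proof. by rewrite divr_ge0 ?ler0n // ln_ge0 // ler1n. Qed.

(** With k the least number such that k * n exceeds m, the inequality bounds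
    the rate at m by that at n up to the factor (1 + n / m) ^ 3, so the rates
    converge to their infimum. *)
Lemma rate_cvg : cvgn rate.
Proof.
pose E := [set rate n | n in [set n | (0 < n)%N]].
have E_inf : has_inf E.
  split; first by exists (rate 1); exists 1%N.
  by exists 0 => _ [n _ <-].
apply/cvg_ex; exists (inf E); apply/cvgrPdist_le => e e_gt0.
have [_ [n n_gt0 <-] rn] : exists2 x, E x & x < inf E + e.
  exact: inf_adherent.
have nR_gt0 : 0 < n%:R :> R by rewrite ltr0n.
pose d := inf E + e - rate n; have d_gt0 : 0 < d by rewrite subr_gt0.
(* As n <= m, the factor (1 + n / m) ^ 3 is at most 1 + 7 n / m. *)
pose M := (Num.trunc (7 * n%:R * rate n / d)).+1.
exists (maxn n M) => // m /=; rewrite geq_max => /andP[nm Mm].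
have m_gt0 : (0 < m)%N by exact: leq_trans nm.
have mR_gt0 : 0 < m%:R :> R by rewrite ltr0n.
have lower : inf E <= rate m by apply: ge_inf; [case: E_inf | exists m].
rewrite distrC ger0_norm ?subr_ge0 // lerBlDl addrC.
have upper : rate m <= rate n * (1 + 7 * (n%:R / m%:R)).
  have := @lnC_mul m n (m %/ n).+1 n_gt0 (ltnW (ltn_ceil m n_gt0)).
  set k : R := _.+1%:R => km.
  have kn : k * n%:R <= m%:R + n%:R.
    rewrite /k -natrM -natrD ler_nat mulSn addnC leq_add2r; exact: leq_divM.
  rewrite /rate !natrX ler_pdivrMr ?exprn_gt0 //; apply: (le_trans km).
  rewrite -!mulrA ler_wpM2l ?ln_ge0 ?ler1n //.
  rewrite ler_pdivlMl ?exprn_gt0 //.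
  have k_ge0 : 0 <= k by exact: ler0n.
  have kn3 : (k * n%:R) ^+ 3 <= (m%:R + n%:R) ^+ 3.
    by rewrite lerXn2r ?nnegrE ?addr_ge0 ?mulr_ge0 ?ler0n.
  have nmR : n%:R <= m%:R :> R by rewrite ler_nat.
  have -> : (1 + 7 * (n%:R / m%:R)) * m%:R ^+ 3 =
      m%:R ^+ 3 + 7 * n%:R * m%:R ^+ 2 :> R.
    by rewrite mulrDl mul1r -!mulrA exprS (mulKf _ (m%:R ^+ 2)) ?lt0r_neq0.
  move: kn3; rewrite exprMn mulrC => /le_trans; apply.
  move: {km kn lower k_ge0} nmR nR_gt0 mR_gt0.
  move: (n%:R) (m%:R) => s t st s_gt0 t_gt0.
  have /ltW s_ge0 := s_gt0; have /ltW t_ge0 := t_gt0.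
  have p1 : 0 <= s * t * (t - s) by rewrite mulr_ge0 ?subr_ge0 // mulr_ge0.
  have p2 : 0 <= s * (t + s) * (t - s).
    by rewrite mulr_ge0 ?subr_ge0 // mulr_ge0 ?addr_ge0.
  by rewrite !exprS !expr0; lra.
apply: (le_trans upper); rewrite mulrDr mulr1.
suff : rate n * (7 * (n%:R / m%:R)) <= d by rewrite /d; lra.
have MR : 7 * n%:R * rate n / d < m%:R.
  apply: lt_le_trans (_ : M%:R <= _); last by rewrite ler_nat.
  apply: truncnS_gt.
move: MR; rewrite ltr_pdivrMr // => /ltW MR.
by rewrite !mulrA ler_pdivrMr // (mulrC d); apply: le_trans MR; lra.
Qed.

(** Comparing the cubes of sides p * t and t, the growth along the multiples
    of p bounds every rate from below by ln 2 / p ^ 3. *)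
Lemma rate_lim_gt0 p : (0 < p)%N -> (forall t, 2 ^ (t ^ 3) <= C (p * t))%N ->
  0 < limn rate.
Proof.
move=> p_gt0 fast; pose c : R := ln 2 / p%:R ^+ 3.
have p3 : 0 < p%:R ^+ 3 :> R by rewrite exprn_gt0 ?ltr0n.
have ln2 : 0 < ln 2 :> R by rewrite ln_gt0 // ltr1n.
have c_gt0 : 0 < c by rewrite divr_gt0.
apply: lt_le_trans c_gt0 _; apply: limr_ge; first exact: rate_cvg.
exists 1%N => // n /= n_gt0.
rewrite /c ler_pdivrMr // /rate mulrAC ler_pdivlMr ?ltr0n ?expn_gt0 ?n_gt0 //.
have := lnC_mul n_gt0 (leqnn (p * n)); apply: le_trans.
rewrite mulr_natr -lnXn // ler_ln ?posrE ?exprn_gt0 ?ltr0n //.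
by rewrite -natrX ler_nat.
Qed.

End Growth.

Lemma positive_entropy (R : realType) (Y : tds R) (U : set (set Y)) N
    (p : nat) :
  (exists y : Y, True) -> open_cover U -> has_subcover U N -> (0 < p)%N ->
  (forall t M, has_subcover (join_cover (@tds_act R Y) (cube (p * t)) U) M ->
     2 ^ (t ^ 3) <= M)%N ->
  (0 < top_entropy R (@tds_act R Y))%E.
Proof.
move=> [y0 _] oU UN p_gt0 fast.
pose C n := cover_number (join_cover (@tds_act R Y) (cube n) U).
have C_cov n : has_subcover (join_cover (@tds_act R Y) (cube n) U) (C n).
  apply: (cover_number_spec _).1; last first.
    apply: (@has_subcover_cube _ _ _ (@tds_actD R Y) n 1 n) => //; first lia.
    exact: join_cover_cube1 (@tds_act0 R Y) UN.
have C_min n M : has_subcover (join_cover (@tds_act R Y) (cube n) U) M ->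
    (C n <= M)%N.
  by move=> /cover_number_spec [].
apply: lt_le_trans (_ : ((cover_entropy R (@tds_act R Y) U)%:E <= _)%E).
  rewrite lte_fin; apply: (@rate_lim_gt0 R C) p_gt0 _ => [n|m n k n0 mkn|t].
  - have [s [_ s_cov]] := C_cov n; have : (\bigcup_i s i) y0 by rewrite s_cov.
    by case=> i _ _; case: (C n) i => [[]|].
  - by apply: C_min; apply: has_subcover_cube (C_cov n) => //; exact: tds_actD.
  - exact: fast (C_cov _).
by apply: ereal_sup_ubound; exists U.
Qed.

(** * Completely positive entropy *)

Section Factor.
Variables (R : realType) (Y : tds R) (f : points cascade -> Y).
Hypothesis f_cont : continuous f.
Hypothesis f_act : forall g p, f (subshift_act g p) = tds_act g (f p).

Lemma factor_nbhs x (vx : valid x) (B : set Y) : nbhs (f (point_of vx)) B ->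
  exists n, forall y (vy : valid y), agree n x y -> B (f (point_of vy)).
Proof.
move=> /f_cont /nbhs_points [n nB]; exists n => y vy xy.
exact: (nB (point_of vy)).
Qed.

(** Closures are separated so that their complements form an open cover. *)
Lemma disjoint_nbhs (y1 y2 : Y) : y1 <> y2 -> exists A B : set Y,
  [/\ nbhs y1 A, nbhs y2 B & closure A `&` closure B = set0].
Proof.
move=> /eqP ne12.
have := @metric_hausdorff R Y; rewrite open_hausdorff => /(_ _ _ ne12).
case=> -[A B] /= [/set_mem Ay1 /set_mem By2] [oA oB AB].
have [C nC CB] : exists2 C, nbhs y2 C & closure C `<=` B.
  have := @uniform_regular Y y2 B; apply.
  exact: open_nbhs_nbhs.
exists A, C; split=> //; first exact: open_nbhs_nbhs.
apply/seteqP; split=> // y [clA /CB By].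
have [w [Aw Bw]] := clA B (open_nbhs_nbhs (conj oB By)).
by have : (A `&` B) w by []; rewrite (eqP AB).
Qed.

(** The complements of the closures of disjoint neighbourhoods A of f x and B
    of f y form a cover. For each labelling e of the cells of a cube by x or y
    there is a point of the subshift showing x or y at each cell as prescribed.
    The images of the points of two labellings that differ at some cell cannot
    lie in a common member of the refined cover: at this cell one image is in A
    and the other one in B, and each set of the cover misses one of them. *)
Lemma asymptotic_factor x y (vx : valid x) (vy : valid y) (m : int) :
  (forall a b c, array x a b c != array y a b c ->
    [&& `|a| <= m, `|b| <= m & `|c| <= m]) ->
  f (point_of vx) <> f (point_of vy) ->
  (0 < top_entropy R (@tds_act R Y))%E.
Proof.
move=> close ne_f.
have [A [B [nA nB AB]]] := disjoint_nbhs ne_f.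
have [n1 n1A] := factor_nbhs nA; have [n2 n2B] := factor_nbhs nB.
pose n := (n1 + n2 + absz m + 3)%N.
pose p := (4 * n + 2)%N.
have pE : p%:Z = period n%:Z by rewrite /p /period; lia.
pose U := [set V | V = ~` closure A \/ V = ~` closure B].
have covU : open_cover U.
  split=> [V [->|->]|]; try exact/closed_openC/closed_closure.
  apply/seteqP; split=> // w _.
  have [cA|nA'] := pselect (closure A w); last first.
    by exists (~` closure A); [left|].
  exists (~` closure B); [by right|] => cB.
  by have : (closure A `&` closure B) w by []; rewrite AB.
have sub2 : has_subcover U #|{: bool}|.
  apply: (@has_subcover_fin _ _ _
    (fun e : bool => if e then ~` closure A else ~` closure B)).
    by case; [left|right].
  move=> w; have [cA|nA'] := pselect (closure A w); last by exists true.
  exists false => cB.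
  by have : (closure A `&` closure B) w by []; rewrite AB.
apply: (positive_entropy (p := p) _ covU sub2).
  by exists (f (point_of vx)).
  by rewrite /p addn2.
move=> t M [s [sU s_cov]].
pose I := {ffun 'I_3 -> 'I_t}.
(* Translating by g i brings the cell of index - i to the origin. *)
pose g (i : I) := pt (p * i ix)%N%:Z (p * i iy)%N%:Z (p * i iz)%N%:Z.
pose E (e : {ffun I -> bool}) (a b c : int) := [exists i : I, e i &&
  [&& - a == (i ix : nat)%:Z, - b == (i iy : nat)%:Z & - c == (i iz : nat)%:Z]].
have EE (e : {ffun I -> bool}) (i : I) :
    E e (- (i ix : nat)%:Z) (- (i iy : nat)%:Z) (- (i iz : nat)%:Z) = e i.
  apply/existsP/idP => [[j /andP[ej]]|ei]; last first.
    by exists i; rewrite ei !opprK !eqxx.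
  rewrite !opprK !eqz_nat => /and3P[ex ey ez]; suff -> : i = j by [].
  apply/ffunP => k; apply/val_inj.
  have [->|[->|->]] : k = ix \/ k = iy \/ k = iz.
    case: k => -[|[|[|//]]] lt_k3; [left|right; left|right; right];
      exact: val_inj.
  - exact/eqP.
  - exact/eqP.
  - exact/eqP.
pose z e := of_array (transplant (array x) (array y) (E e) (absz m)%:Z n%:Z).
have close' a b c : array x a b c != array y a b c ->
    [&& `|a| <= (absz m)%:Z, `|b| <= (absz m)%:Z & `|c| <= (absz m)%:Z].
  by move=> /close; lia.
have vz e : valid (z e).
  rewrite /valid /= of_arrayK; apply: facilitated_transplant => //; lia.
have near (e : {ffun I -> bool}) (i : I) :
    agree n (if e i then y else x) (shift (g i) (z e)).
  move=> a b c an bn cn; rewrite array_shift of_arrayK !PoszM !pE.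
  have cw (q d : int) : `|d| <= n%:Z ->
      cell n (d - period n%:Z * q) = - q /\ offset n (d - period n%:Z * q) = d.
    move=> dn; have -> : d - period n%:Z * q = - q * period n%:Z + d.
      by rewrite mulNr mulrC addrC.
    exact: offset_cell.
  have [ca wa] := cw (i ix : nat)%:Z a an.
  have [cb wb] := cw (i iy : nat)%:Z b bn.
  have [cc wc] := cw (i iz : nat)%:Z c cn.
  by rewrite transplant_inside // ?wa ?wb ?wc // ca cb cc EE; case: (e i).
have /choice[k kP] e : exists k, s k (f (point_of (vz e))).
  have : (\bigcup_i s i) (f (point_of (vz e))) by rewrite s_cov.
  by case=> k _ sk; exists k.
suff k_inj : injective k.
  have := leq_card k k_inj; rewrite card_ffun card_bool card_ord.
  by rewrite card_ffun !card_ord.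
move=> e e' ke; apply/ffunP => i; apply/eqP; apply: contraT => ne_e.
wlog ei : e e' ke ne_e / e i.
  move=> wl; have [ei|nei] := boolP (e i); first exact: wl ke ne_e ei.
  apply: wl (esym ke) _ _; first by rewrite eq_sym.
  by move: ne_e; rewrite (negbTE nei); case: (e' i).
have e'i : ~~ e' i by move: ne_e; rewrite ei; case: (e' i).
have [phi phiU sE] := sU (k e).
have gi : cube (p * t) (g i).
  move=> j; rewrite mxE.
  have lt_i l : (p * i l < p * t)%N by rewrite ltn_mul2l ltn_ord /p addn2.
  by case: j => -[|[|[|//]]] ? /=; rewrite ltz_nat lt_i.
have at_e d : s (k e) (f (point_of (vz d))) ->
    phi (g i) (f (point_of (valid_shift (g := g i) (vz d)))).
  rewrite -sE => /(_ _ gi) /=; rewrite -f_act; congr (phi _ (f _)).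
  exact: val_inj.
have inB : B (f (point_of (valid_shift (g := g i) (vz e)))).
  by apply: n2B; have := near e i; rewrite ei; apply: agree_le; lia.
have inA : A (f (point_of (valid_shift (g := g i) (vz e')))).
  by apply: n1A; have := near e' i; rewrite (negbTE e'i); apply: agree_le; lia.
have := at_e e (kP e); have := at_e e'; rewrite ke => /(_ (kP e')).
have [->|->] := phiU _ gi => inA' inB'.
- by case: inA'; exact: subset_closure.
- by case: inB'; exact: subset_closure.
Qed.

Definition same x y := forall (vx : valid x) (vy : valid y),
  f (point_of vx) = f (point_of vy).

Lemma same_closed x y :
  (forall n, exists x' y', [/\ valid x', valid y', agree n x x', agree n y y'
    & same x' y']) -> same x y.
Proof.
move=> approx vx vy; apply: contrapT => ne_f.
have [A [B [nA nB AB]]] := disjoint_nbhs ne_f.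
have [m mA] := factor_nbhs nA; have [n nB'] := factor_nbhs nB.
have [x' [y' [vx' vy' xx' yy' same']]] := approx (maxn m n).
have : (closure A `&` closure B) (f (point_of vx')).
  split; apply: subset_closure.
    by apply: mA; apply: agree_le xx'; exact: leq_maxl.
  by rewrite (same' vx' vy'); apply: nB'; apply: agree_le yy'; exact: leq_maxr.
by rewrite AB.
Qed.

Hypothesis zero_entropy : ~ (0 < top_entropy R (@tds_act R Y))%E.

Lemma same_asymptotic x y (m : int) :
  (forall a b c, array x a b c != array y a b c ->
    [&& `|a| <= m, `|b| <= m & `|c| <= m]) -> same x y.
Proof.
move=> close vx vy; apply: contrapT => ne_f.
exact/zero_entropy/(asymptotic_factor close ne_f).
Qed.

Lemma same_trans x y z : valid y -> same x y -> same y z -> same x z.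
Proof. by move=> vy xy yz vx vz; rewrite (xy vx vy) (yz vy vz). Qed.

Definition rows (r : int -> int -> bool) := of_array (fun _ b c => r b c).

Lemma valid_rows r : valid (rows r).
Proof. by move=> a b c; rewrite of_arrayK /jump eqxx. Qed.

Arguments valid_rows r : clear implicits.

(** The rows above k being 1, the pyramids with top row k + 2 and with top row
    k are both close to a configuration with constant rows when they are high,
    and they differ only on an interval of the rows k. *)
Lemma raise_row (r : int -> int -> bool) (n k : int) :
  (forall b c, k < b -> r b c) -> (forall b c, n < `|c| -> r b c) ->
  same (rows r) (rows (fun b c => r b c || (b == k))).
Proof.
move=> above beside; apply: same_closed => N.
pose S c := (`|c| <= n) && ~~ r k c.
(* On the box of radius N, 2 * |a| + (b - k) < 2 * h: the pyramids are 1. *)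
pose h : int := 2 * N%:Z + `|k| + 1.
exists (of_array (pyramid r S (k + 2) (h - 1))), (of_array (pyramid r S k h)).
split.
- rewrite /valid /= of_arrayK; apply: facilitated_pyramid => b c kb.
  by apply: above; lia.
- by rewrite /valid /= of_arrayK; exact: facilitated_pyramid.
- move=> a b c aN bN cN; rewrite !of_arrayK /pyramid; case: ifP => // cond.
  by rewrite above; lia.
- move=> a b c aN bN cN; rewrite !of_arrayK /pyramid; case: ifPn => [cond|].
    have [->|bk] := eqVneq b k; first by rewrite orbT; lia.
    by rewrite above; lia.
  have [->|_] := eqVneq b k; last by rewrite orbF.
  rewrite subrr lexx andbT /= orbT /S negb_and negbK -ltNge.
  by case/orP => [/beside ->|->].
apply: (@same_asymptotic _ _ (h + `|k| + `|n|)) => a b c.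
rewrite !of_arrayK /pyramid.
have [/and3P[Sc kb even_b]|] := boolP [&& S c, k <= b & ~~ odd `|(b - k)%R|];
    last first.
  move=> no; rewrite ifF ?eqxx //; apply/negP => /and3P[Sc kb even_b].
  by case/negP: no; rewrite Sc; lia.
have [ebk|bk] := eqVneq b k; last first.
  have -> : [&& S c, k + 2 <= b & ~~ odd `|(b - (k + 2))%R|] by rewrite Sc; lia.
  by lia.
have -> : (k + 2 <= b) = false by lia.
rewrite andbF; move: Sc; rewrite /S ebk => /andP[cn /negbTE ->].
lia.
Qed.

(** Raise the rows from the top down, in all layers at once. *)
Lemma same_rows_ones (r : int -> int -> bool) (n k : int) (j : nat) :
  (forall b c, k < b -> r b c) -> (forall b c, n < `|c| -> r b c) ->
  (forall b c, b <= k - j%:Z -> r b c) ->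
  same (rows r) (rows (fun _ _ => true)).
Proof.
move=> above beside below; elim: j => [|j IHj] in r k above beside below *.
  suff -> : r = fun _ _ => true by move=> vx vy; congr (f _); exact: val_inj.
  apply/funext => b; apply/funext => c.
  have [kb|bk] := ltP k b; first exact: above.
  by apply: below; lia.
apply: (same_trans (valid_rows _) (raise_row above beside)).
apply: (IHj _ (k - 1)) => b c.
- by move=> kb; have [->|bk] := eqVneq b k; rewrite ?orbT // above //; lia.
- by move=> /beside ->.
- by move=> bk; rewrite below //; lia.
Qed.

(** The truncation of x, folded by bump_map, is close to x, and differs in
    finitely many sites from the configuration whose rows are constant with the
    values of the truncation at a = 0. *)
Lemma same_ones x : valid x -> same x (rows (fun _ _ => true)).
Proof.
move=> vx; apply: same_closed => n.
pose u := truncate (array x) n%:Z.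
have vu : facilitated u by exact: facilitated_truncate.
pose x' := of_array (fun a b c => u (bump_map n%:Z a) b c).
exists x', (rows (fun _ _ => true)).
have vx' : valid x'.
  rewrite /valid /= of_arrayK.
  apply: (facilitated_comp (g := id) (h := id) vu) => [a|b]; last by right.
  exact: bump_map_lip.
split=> //.
- move=> a b c an bn cn; rewrite of_arrayK /u truncate_inside //.
  by rewrite /bump_map an.
apply: (same_trans (y := rows (fun b c => u 0 b c))).
- exact: valid_rows.
- apply: (@same_asymptotic _ _ (2 * n%:Z + 2)) => a b c.
  rewrite !of_arrayK => ne_u.
  have an : `|a| <= 2 * n%:Z.
    rewrite leNgt; apply/negP => an; move: ne_u.
    by rewrite bump_map_far ?eqxx //; exact: ltW.
  have bn : `|b| <= n%:Z.
    rewrite leNgt; apply/negP => bn; move: ne_u.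
    by rewrite /u (truncate_row _ (bump_map n%:Z a) 0 _ bn) eqxx.
  have cn : `|c| <= n%:Z.
    rewrite leNgt; apply/negP => cn; move: ne_u.
    by rewrite /u !truncate_outside ?eqxx //; left.
  by apply/and3P; split; lia.
- apply: (@same_rows_ones _ n%:Z (n%:Z + 2) (2 * n + 5)) => b c bc;
    by apply: truncate_outside; lia.
Qed.

End Factor.

Arguments valid_rows r : clear implicits.

Lemma cascade_CPE (R : realType) : top_CPE R (@subshift_act bool cascade).
Proof.
move=> Y [f [f_cont f_surj f_act]] [y [y' ne_y]]; apply: contrapT => zero.
have one w : w = f (point_of (valid_rows (fun _ _ => true))).
  have : range f w by rewrite f_surj.
  case=> p _ <-; have vp : valid (val p) by exact: set_valP.
  rewrite -(same_ones f_cont f_act zero vp vp); congr (f _); exact: val_inj.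
by apply: ne_y; rewrite (one y) (one y').
Qed.

Theorem theorem6p22 (R : realType) :
  exists (A : finType) (X : subshift A),
    [/\ is_SFT X,
        weakly_mixing (@subshift_act A X),
        top_CPE R (@subshift_act A X) &
        ~ BCE X].
Proof.
exists bool, cascade; split.
- exact: cascade_SFT.
- exact: cascade_mixing.
- exact: cascade_CPE.
- exact: not_BCE.
Qed.
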